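(* For every integer $n\ge 0$, \[ \overline{p}_o(n)=\sum_{k=0}^{\infty}\mathrm{pod}(n-\tfrac{k(k+1)}{2}). \]
   Context: $\overline{p}_o(n)$ denotes the number of overpartitions of $n$ into odd parts (partitions into odd parts in which the first occurrence of each part size may be overlined); $\sum_{n\ge0}\overline{p}_o(n)q^n=\frac{(-q;q^2)_\infty}{(q;q^2)_\infty}$, where $(a;q)_\infty=\prod_{k\ge1}(1-aq^{k-1})$. $\mathrm{pod}(n)$ denotes the number of partitions of $n$ in which odd parts are distinct and even parts are unrestricted; $\sum_{n\ge0}\mathrm{pod}(n)q^n=\frac{(-q;q^2)_\infty}{(q^2;q^2)_\infty}$. Convention: these functions vanish at arguments that are not nonnegative integers. *)

(* Defs.v *)
From mathcomp Require Import all_boot all_order all_algebra.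
From mathcomp Require Import classical_sets cardinality fsbigop.

Set Implicit Arguments.
Unset Strict Implicit.
Unset Printing Implicit Defensive.

Definition is_partition (n : nat) (s : seq nat) : bool :=
  [&& sorted geq s, all (fun x => 0 < x) s & sumn s == n].

(* An overpartition is a sequence of parts, each with a flag saying whether it
   is overlined. In a nonincreasing sequence equal parts are adjacent, so
   "the first occurrence of each part size may be overlined" says that every
   flagged position i is the first index at which its part size occurs. *)
Definition is_overpartition (n : nat) (s : seq (nat * bool)) : bool :=
  is_partition n (unzip1 s) &&
  all (fun i => nth false (unzip2 s) i ==>
                (index (nth 0 (unzip1 s) i) (unzip1 s) == i))
      (iota 0 (size s)).

Definition bvals (n : nat) (t : seq 'I_n.+1) : seq nat :=
  [seq val x | x <- t].

Definition obvals (n : nat) (t : seq ('I_n.+1 * bool)) : seq (nat * bool) :=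
  [seq (val x.1, x.2) | x <- t].

(* A partition of n has at most n parts, each at most n, so all of them are
   found in the finite type of sequences of length <= n over 'I_n.+1: see
   partition_bounded and overpartition_bounded below. *)
Definition pod (n : nat) : nat :=
  #|[set t : n.-bseq 'I_n.+1 |
      is_partition n (bvals t) && uniq [seq x <- bvals t | odd x]]|.

Definition pobar (n : nat) : nat :=
  #|[set t : n.-bseq ('I_n.+1 * bool) |
      is_overpartition n (obvals t) && all odd (unzip1 (obvals t))]|.

Definition podz (z : int) : nat := if z is Posz m then pod m else 0.

Lemma bvals_inj (n : nat) : injective (@bvals n).
Proof. exact: inj_map val_inj. Qed.

Lemma obvals_inj (n : nat) : injective (@obvals n).
Proof. by apply: inj_map => -[x b] [y c] [/val_inj-> ->]. Qed.

Lemma partition_leq (n : nat) (s : seq nat) :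
  is_partition n s -> size s <= n /\ all (fun x => x < n.+1) s.
Proof.
case/and3P=> _ + /eqP<-; elim: s => //= x s IHs /andP[x0 /IHs[szs les]].
split; first by rewrite -add1n leq_add.
rewrite ltnS leq_addr /=; apply: sub_all les => y.
by rewrite !ltnS => /leq_trans; apply; rewrite leq_addl.
Qed.

Lemma partition_bounded (n : nat) (s : seq nat) :
  is_partition n s -> exists t : n.-bseq 'I_n.+1, bvals t = s.
Proof.
move=> /partition_leq[szs les].
have szt : size (map (@inord n) s) <= n by rewrite size_map.
exists (Bseq szt); rewrite /bvals /= -map_comp map_id_in // => x xs /=.
by rewrite inordK // (allP les).
Qed.

Lemma overpartition_bounded (n : nat) (s : seq (nat * bool)) :
  is_overpartition n s -> exists t : n.-bseq ('I_n.+1 * bool), obvals t = s.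
Proof.
move=> /andP[/partition_leq[szs les] _]; rewrite size_map in szs.
have szt : size [seq (@inord n x.1, x.2) | x <- s] <= n by rewrite size_map.
exists (Bseq szt); rewrite /obvals /= -map_comp map_id_in // => -[x b] xs /=.
by rewrite inordK // (allP les) //; apply/mapP; exists (x, b).
Qed.

Section FiniteSupport.
Local Open Scope classical_set_scope.
Local Open Scope ring_scope.

(* A finitely supported sum over a set takes a default value when the support
   is infinite; here it never is. *)
Lemma podz_finite_support (n : nat) :
  finite_set [set k : nat | podz (n%:Z - (k * k.+1 %/ 2)%N%:Z) != 0%N].
Proof.
apply: (sub_finite_set _ (finite_II n.+1)) => k /=.
apply: contra_neqT; rewrite -leqNgt => nk.
have lt_n : (n < k * k.+1 %/ 2)%N.
  apply: (leq_trans nk); rewrite leq_divRL // leq_mul2l.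
  by case: k nk => // k _; rewrite orbT.
suff : n%:Z - (k * k.+1 %/ 2)%N%:Z < 0 by case: (_ - _).
by rewrite Num.Theory.subr_lt0.
Qed.

End FiniteSupport.

(* Main.v *)
Require Import Defs.
From mathcomp Require Import all_boot all_order all_algebra.
From mathcomp Require Import classical_sets cardinality fsbigop.
From mathcomp Require Import ring zify.

Set Implicit Arguments.
Unset Strict Implicit.
Unset Printing Implicit Defensive.

Import GRing.Theory.

(** The generating functions reduce the statement to Gauss's identity
      (q^2;q^2)_oo / (q;q^2)_oo = \sum_k q^(k(k+1)/2).
    It follows from Shanks's finite identity
      (q;q^2)_n \sum_(j < 2n) q^(j(j+1)/2)
        = \sum_(s < n) q^(s(2n+1)) (q;q^2)_s \prod_(s < k <= n) (1 - q^(2k)),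
    since modulo q^(2n+1) only the term s = 0 survives on the right. All
    generating functions are polynomials truncated modulo 'X^N, and the factors
    (1 - q^m)^-1 are cleared by multiplying through. *)

(** * Shanks's finite form of Gauss's identity *)

Section ShanksIdentity.
Local Open Scope ring_scope.
Variables (R : comNzRingType) (q : R).

Definition odd_poch (n : nat) : R := \prod_(k < n) (1 - q ^+ k.*2.+1).

(** For s <= n this is (q;q^2)_s (q^2;q^2)_n / (q^2;q^2)_s, written without division. *)
Definition shanks_term (n s : nat) : R :=
  odd_poch s * \prod_(s <= k < n) (1 - q ^+ k.+1.*2).

Lemma odd_pochS (n : nat) : odd_poch n.+1 = odd_poch n * (1 - q ^+ n.*2.+1).
Proof. by rewrite /odd_poch big_ord_recr. Qed.

Lemma shanks_termSn (n s : nat) : (s <= n)%N ->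
  shanks_term n.+1 s = shanks_term n s * (1 - q ^+ n.+1.*2).
Proof. by move=> sn; rewrite /shanks_term big_nat_recr //= mulrA. Qed.

Lemma shanks_term_shift (n s : nat) : (s < n)%N ->
  (1 - q ^+ s.*2.+1) * shanks_term n s = (1 - q ^+ s.+1.*2) * shanks_term n s.+1.
Proof.
by move=> sn; rewrite /shanks_term odd_pochS big_ltn //=; ring.
Qed.

Lemma shanks_termnn (n : nat) : shanks_term n n = odd_poch n.
Proof. by rewrite /shanks_term big_geq // mulr1. Qed.

(* Passing from n to n+1, the difference of the right-hand sides telescopes:
   q^(2s) (1 - q^(2n+2)) - (1 - q^(2n+1))
     = q^(2n+1) (1 - q^(2s+1)) - (1 - q^(2s)). *)
Lemma shanks_identity (n : nat) :
  odd_poch n * \sum_(j < n.*2) q ^+ (j * j.+1 %/ 2) =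
  \sum_(s < n) q ^+ (s * n.*2.+1) * shanks_term n s.
Proof.
elim: n => [|n IHn]; first by rewrite !big_ord0 mulr0.
rewrite doubleS !big_ord_recr /=.
have -> : (n.*2 * n.*2.+1 %/ 2 = n * n.*2.+1)%N.
  by rewrite -(mulnK (n * _) (isT : (0 < 2)%N)); congr (_ %/ _)%N; lia.
have -> : (n.*2.+1 * n.*2.+2 %/ 2 = n * n.*2.+1 + n.*2.+1)%N.
  by rewrite -(mulnK (_ + _) (isT : (0 < 2)%N)); congr (_ %/ _)%N; lia.
rewrite odd_pochS.
pose h s := q ^+ (s * n.*2.+1) * (1 - q ^+ s.*2) * shanks_term n s.
have -> : \sum_(s < n) q ^+ (s * n.*2.+3) * shanks_term n.+1 s =
    (1 - q ^+ n.*2.+1) * (\sum_(s < n) q ^+ (s * n.*2.+1) * shanks_term n s)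
    + \sum_(0 <= s < n) (h s.+1 - h s).
  rewrite big_mkord mulr_sumr -big_split; apply: eq_bigr => -[s sn] _ /=.
  rewrite shanks_termSn ?(ltnW sn) // /h -[_ * shanks_term n s.+1]mulrA.
  rewrite -shanks_term_shift //.
  have -> : (s * n.*2.+3 = s * n.*2.+1 + s.*2)%N by lia.
  rewrite mulSn doubleS !exprS !exprD; ring.
(* The factor 1 - q^0 kills [h 0], so the telescoping sum leaves only [h n]. *)
rewrite telescope_sumr // /h mul0n double0 expr0 subrr mulr0 mul0r subr0.
rewrite -IHn shanks_termSn // shanks_termnn.
have -> : (n * n.*2.+3 = n * n.*2.+1 + n.*2)%N by lia.
rewrite doubleS !exprD !exprS; ring.
Qed.

End ShanksIdentity.

(** * Power series as polynomials modulo a power of ['X] *)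

Section Truncation.
Local Open Scope ring_scope.
Variable N : nat.

Definition eqtrunc (p r : {poly rat}) : bool := 'X^N %| p - r.

Lemma eqtruncP (p r : {poly rat}) :
  reflect (forall i, (i < N)%N -> p`_i = r`_i) (eqtrunc p r).
Proof.
apply: (iffP idP) => [/dvdpP[u pru] i iN | pr].
  apply/eqP; rewrite -subr_eq0 -coefB pru coefMXn iN //.
rewrite /eqtrunc -[p - r](poly_take_drop N).
suff -> : take_poly N (p - r) = 0 by rewrite add0r dvdp_mull.
apply/polyP=> i; rewrite coef_take_poly coef0; case: ifP => // /pr eq_i.
by rewrite coefB eq_i subrr.
Qed.

Lemma eqtrunc_sym p r : eqtrunc p r -> eqtrunc r p.
Proof. by move/eqtruncP=> pr; apply/eqtruncP=> i /pr. Qed.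

Lemma eqtrunc_trans p r t : eqtrunc p r -> eqtrunc r t -> eqtrunc p t.
Proof.
by move=> /eqtruncP pr /eqtruncP rt; apply/eqtruncP=> i iN; rewrite pr ?rt.
Qed.

Lemma eqtruncMl t p r : eqtrunc p r -> eqtrunc (t * p) (t * r).
Proof. by rewrite /eqtrunc -mulrBr => ?; apply: dvdp_mull. Qed.

Lemma eqtruncMr t p r : eqtrunc p r -> eqtrunc (p * t) (r * t).
Proof. by rewrite ![_ * t]mulrC; apply: eqtruncMl. Qed.

(** A nonzero constant term makes [t] coprime to ['X], hence to ['X^N], and Gauss's lemma
    applies. *)
Lemma eqtrunc_cancel (t p r : {poly rat}) :
  t`_0 != 0 -> eqtrunc (t * p) (t * r) -> eqtrunc p r.
Proof.
move=> t0; rewrite /eqtrunc -mulrBr Gauss_dvdpr //.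
apply: coprimep_expl; rewrite coprimep_sym coprimepX.
by rewrite /root horner_coef0.
Qed.

Definition gf (c : nat -> nat) : {poly rat} := \poly_(i < N) (c i)%:R.

Lemma gf_rec (a b c : nat -> nat) (m : nat) :
  (forall n, a n = b n + (if m <= n then c (n - m) else 0))%N ->
  eqtrunc (gf a) (gf b + 'X^m * gf c).
Proof.
move=> abc; apply/eqtruncP=> i iN.
rewrite coefD coefXnM !coef_poly iN abc natrD; case: leqP => //= _.
by rewrite (leq_ltn_trans (leq_subr _ _) iN).
Qed.

Lemma gf_delta0 (c : nat -> nat) :
  (forall n, c n = (n == 0)%N) -> eqtrunc (gf c) 1.
Proof.
by move=> c0; apply/eqtruncP=> i iN; rewrite coef_poly iN c0 coef1.
Qed.

Lemma eq_gf (a b : nat -> nat) : a =1 b -> gf a = gf b.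
Proof. by move=> ab; apply/polyP=> i; rewrite !coef_poly ab. Qed.

(** A recurrence that feeds [a] back into itself describes a part m that may repeat; its factor (1 -
    q^m)^-1 is moved to the other side. *)
Lemma gf_geom (a b : nat -> nat) (m : nat) :
  (forall n, a n = b n + (if m <= n then a (n - m) else 0))%N ->
  eqtrunc (gf a * (1 - 'X^m)) (gf b).
Proof.
move/gf_rec; rewrite /eqtrunc.
by have -> : gf a * (1 - 'X^m) - gf b = gf a - (gf b + 'X^m * gf a) by ring.
Qed.

End Truncation.

Lemma gauss_trunc (N n : nat) : N <= n ->
  eqtrunc N (odd_poch 'X n * \sum_(j < n.*2) 'X^(j * j.+1 %/ 2))%R
            (\prod_(k < n) (1 - 'X^(k.+1.*2)))%R.
Proof.
case: n => [|n] Nn.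
  (* Here n = 0 forces N = 0, and congruence modulo ['X^0] = 1 is trivial. *)
  by rewrite !big_ord0 /eqtrunc; case: N Nn => // _; rewrite expr0 dvd1p.
rewrite shanks_identity [X in eqtrunc _ X _]big_ord_recl /= mul0n expr0 mul1r.
rewrite /eqtrunc.
rewrite {1}/shanks_term {1}/odd_poch big_ord0 mul1r big_mkord addrC addKr.
apply: (big_ind (fun p => 'X^N %| p)%R) => [|p r|i _]; first exact: dvdp0.
  exact: dvdp_add.
(* The term of index s = i+1 carries the exponent s(2n+3), at least N because N <= n+1. *)
apply: dvdp_mulr; apply: dvdp_exp2l; rewrite /bump /=; nia.
Qed.

(** * Counting by duplicate-free lists *)

(** The finite types behind the cardinals change with n; lists over one common type let the counts
    for n and n - m be compared. *)
Definition counts (T : eqType) (P : pred T) (c : nat) : Prop :=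
  exists L : seq T, [/\ uniq L, L =i P & size L = c].

Section Counts.
Variable T : eqType.

Lemma counts_unique (P : pred T) (c d : nat) :
  counts P c -> counts P d -> c = d.
Proof.
move=> [L [uL LP <-]] [M [uM MP <-]]; apply: perm_size.
by apply: uniq_perm => // x; rewrite LP MP.
Qed.

Lemma eq_counts (P Q : pred T) (c : nat) : P =1 Q -> counts P c -> counts Q c.
Proof.
by move=> PQ [L [uL LP szL]]; exists L; split=> // x; rewrite LP; apply: PQ.
Qed.

Lemma counts_pred0 : counts (xpred0 : pred T) 0.
Proof. by exists [::]. Qed.

Lemma countsU (P Q : pred T) (c d : nat) :
  (forall x, P x -> ~~ Q x) -> counts P c -> counts Q d ->
  counts (fun x => P x || Q x) (c + d).
Proof.
move=> PQ [L [uL LP <-]] [M [uM MQ <-]]; exists (L ++ M).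
rewrite size_cat; split=> // [|x]; last by rewrite mem_cat LP MQ.
rewrite cat_uniq uL uM andbT /=; apply/hasPn => x; rewrite MQ LP => Qx.
by apply/negP => /PQ /negP; apply.
Qed.

Definition cons_pred (x : T) (P : pred (seq T)) : pred (seq T) :=
  fun s => if s is y :: s' then (y == x) && P s' else false.

Lemma counts_cons (x : T) (P : pred (seq T)) (c : nat) :
  counts P c -> counts (cons_pred x P) c.
Proof.
move=> [L [uL LP <-]]; exists (map (cons x) L); rewrite size_map; split=> //.
  by rewrite map_inj_uniq // => s t [].
move=> s; rewrite [RHS]unfold_in; apply/mapP/idP => [[t tL ->]|] /=.
  by rewrite eqxx; move: tL; rewrite LP.
by case: s => //= y s /andP[/eqP-> Ps]; exists s; rewrite ?LP.
Qed.

(** In use, [b] says that the removed part is at most n: subtraction of naturals truncates, so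
    larger parts must be excluded explicitly. *)
Lemma counts_cons_if (x : T) (P : pred (seq T)) (b : bool) (c : nat) :
  (b -> counts P c) ->
  counts (cons_pred x (fun s => b && P s)) (if b then c else 0).
Proof.
move=> Pc; apply: counts_cons; case: b Pc => [/(_ isT)|_] //.
by exists [::].
Qed.

Lemma counts_card (fT : finType) (v : fT -> T) (P : pred T) :
  injective v -> (forall x, P x -> exists t, v t = x) ->
  counts P #|[set t | P (v t)]|.
Proof.
move=> v_inj onto; exists (map v (enum [set t | P (v t)])).
rewrite size_map -cardE map_inj_uniq ?enum_uniq //; split=> // x.
apply/mapP/idP => [[t + ->]|Px]; first by rewrite mem_enum inE.
by have [t tx] := onto x Px; exists t; rewrite // mem_enum inE tx.
Qed.

End Counts.

Lemma is_partition_cons (n y : nat) (s : seq nat) :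
  is_partition n (y :: s) =
  [&& 0 < y, y <= n, all (leq^~ y) s & is_partition (n - y) s].
Proof.
rewrite /is_partition /= path_sortedE; last by move=> a b c ab /leq_trans; apply.
have -> : (y + sumn s == n) = (y <= n) && (sumn s == n - y) by lia.
have -> : all (geq y) s = all (leq^~ y) s by [].
by do ![case: (all _ _) => //=] ; lia.
Qed.

(** * Partitions with distinct odd parts, by largest part *)

Definition pod_pred (m n : nat) : pred (seq nat) := fun s =>
  [&& is_partition n s, uniq [seq x <- s | odd x] & all (leq^~ m) s].

Definition pod_le (m n : nat) : nat :=
  #|[set t : n.-bseq 'I_n.+1 | pod_pred m n (bvals t)]|.

Lemma pod_le_counts (m n : nat) : counts (pod_pred m n) (pod_le m n).
Proof.
apply: (@counts_card _ _ (fun t : n.-bseq 'I_n.+1 => bvals t)).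
  by move=> t u /bvals_inj /val_inj.
by move=> s /and3P[/partition_bounded].
Qed.

Lemma pod_leE (m n : nat) : n <= m -> pod n = pod_le m n.
Proof.
move=> nm; congr #|pred_of_set _|; apply/setP => t; rewrite !inE /pod_pred.
case: (boolP (is_partition _ _)) => //= /partition_leq[_ le_n].
rewrite [X in _ && X](_ : _ = true) ?andbT //.
by apply: sub_all le_n => x; rewrite ltnS => /leq_trans; apply.
Qed.

(* An odd part occurs at most once, so below it the bound drops by one. *)
Lemma pod_pred_cons (m n y : nat) (s : seq nat) :
  pod_pred m n (y :: s) =
  [&& 0 < y, y <= m, y <= n & pod_pred (if odd y then y.-1 else y) (n - y) s].
Proof.
rewrite /pod_pred is_partition_cons /=.
have [->|y0] := posnP y; rewrite //=.
case: (leqP y n) => //= _; last by rewrite andbF.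
case: (leqP y m) => //= ym; last by rewrite !andbF.
case: (is_partition _ _); last by rewrite andbF.
rewrite andbT /=.
have allm : all (leq^~ y) s -> all (leq^~ m) s.
  by apply: sub_all => x /leq_trans; apply.
case: ifP => oy /=; last first.
  by case: (boolP (all (leq^~ y) s)) => [/allm->|]; rewrite ?andbT ?andbF.
rewrite mem_filter oy /=.
case: (uniq _); rewrite ?andbF //= ?andbT.
apply/and3P/idP => [[ys yn _]|ys].
  apply/allP => x xs; have := allP ys x xs.
  by rewrite leq_eqVlt => /predU1P[xy|]; [rewrite -xy xs in yn | lia].
have ys' : all (leq^~ y) s by apply: sub_all ys => x; lia.
by split; [| apply/negP => /(allP ys); lia | apply: allm].
Qed.

Lemma pod_le0 (n : nat) : pod_le 0 n = (n == 0).
Proof.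
apply: counts_unique (pod_le_counts 0 n) _.
have [->|n0] := eqVneq n 0.
  exists [:: [::]]; split=> // -[|y s]; rewrite !inE //.
  by rewrite -[RHS]/(pod_pred 0 0 (y :: s)) pod_pred_cons; case: y.
apply: eq_counts (counts_pred0 _) => -[|y s].
  by rewrite /pod_pred /is_partition /= eq_sym (negPf n0).
by rewrite pod_pred_cons; case: y.
Qed.

(** Either all parts are at most m, or the leading part is m+1 and is removed. An even m+1 may then
    occur again, an odd one may not, which sets the new bound. *)
Lemma pod_leS (m n : nat) :
  pod_le m.+1 n = pod_le m n +
    (if m.+1 <= n then pod_le (if odd m.+1 then m else m.+1) (n - m.+1) else 0).
Proof.
apply: counts_unique (pod_le_counts m.+1 n) _.
apply: eq_counts (countsU _ (pod_le_counts m n)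
  (counts_cons_if m.+1 (fun _ => pod_le_counts _ _))) => [] [|y s] //.
  by rewrite /cons_pred orbF /pod_pred /= !andbT.
- rewrite !pod_pred_cons /=; case: eqP => [->|ym] /=.
    by rewrite ltnn leqnn.
  by rewrite orbF; have -> : (y <= m.+1) = (y <= m) by lia.
- by rewrite pod_pred_cons /= negb_and => /and3P[_ ym _]; apply/orP; left; lia.
Qed.

(** * Overpartitions into odd parts, by largest part *)

Definition flags_ok (s : seq (nat * bool)) : bool :=
  all (fun i => nth false (unzip2 s) i ==>
                (index (nth 0 (unzip1 s) i) (unzip1 s) == i))
      (iota 0 (size s)).

(** The head is a first occurrence whatever its flag, while a later copy of [y] never is; for other
    sizes, prepending [y] shifts position and first index alike. *)
Lemma flags_ok_cons (y : nat) (b : bool) (s : seq (nat * bool)) :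
  flags_ok ((y, b) :: s) = all (fun p => p.2 ==> (p.1 != y)) s && flags_ok s.
Proof.
rewrite /flags_ok /= eqxx implybT /= -[1]addn0 iotaDl all_map.
have -> : all (fun p => p.2 ==> (p.1 != y)) s =
    all (fun i => nth false (unzip2 s) i ==> (nth 0 (unzip1 s) i != y))
        (iota 0 (size s)).
  rewrite -[s in LHS](mkseq_nth (0, false)) all_map.
  apply: eq_in_all => i; rewrite mem_iota /= => i_s.
  by rewrite (nth_map (0, false)) // (nth_map (0, false)).
rewrite -all_predI; apply: eq_all => i /=.
rewrite add1n /= [y == _]eq_sym; case: (nth false _ _) => //=.
by rewrite add0n; case: (_ =P y).
Qed.

Definition ovo_pred (m n : nat) : pred (seq (nat * bool)) := fun s =>
  [&& is_overpartition n s, all odd (unzip1 s) & all (leq^~ m) (unzip1 s)].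

(* "Plain": no part of the maximal allowed size m is overlined; this is what can
   follow a leading part m. *)
Definition ovo_plain_pred (m n : nat) : pred (seq (nat * bool)) := fun s =>
  ovo_pred m n s && all (fun p => p.2 ==> (p.1 != m)) s.

Definition ovo_le (m n : nat) : nat :=
  #|[set t : n.-bseq ('I_n.+1 * bool) | ovo_pred m n (obvals t)]|.

Definition ovo_plain_le (m n : nat) : nat :=
  #|[set t : n.-bseq ('I_n.+1 * bool) | ovo_plain_pred m n (obvals t)]|.

Lemma ovo_le_counts (m n : nat) : counts (ovo_pred m n) (ovo_le m n).
Proof.
apply: (@counts_card _ _ (fun t : n.-bseq ('I_n.+1 * bool) => obvals t)).
  by move=> t u /obvals_inj /val_inj.
by move=> s /and3P[/overpartition_bounded].
Qed.

Lemma ovo_plain_le_counts (m n : nat) :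
  counts (ovo_plain_pred m n) (ovo_plain_le m n).
Proof.
apply: (@counts_card _ _ (fun t : n.-bseq ('I_n.+1 * bool) => obvals t)).
  by move=> t u /obvals_inj /val_inj.
by move=> s /andP[/and3P[/overpartition_bounded]].
Qed.

Lemma ovo_leE (m n : nat) : n <= m -> pobar n = ovo_le m n.
Proof.
move=> nm; congr #|pred_of_set _|; apply/setP => t; rewrite !inE /ovo_pred.
case: (boolP (is_overpartition _ _)) => //= /andP[/partition_leq[_ le_n] _].
rewrite [X in _ && X](_ : _ = true) ?andbT //.
by apply: sub_all le_n => x; rewrite ltnS => /leq_trans; apply.
Qed.

(** The right-hand side ignores [b]: the leading part is overlined or not at will, which is the
    source of the numerator factors 1 + q^m. *)
Lemma ovo_pred_cons (m n y : nat) (b : bool) (s : seq (nat * bool)) :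
  ovo_pred m n ((y, b) :: s) =
  [&& odd y, y <= m, y <= n & ovo_plain_pred y (n - y) s].
Proof.
rewrite /ovo_plain_pred /ovo_pred /is_overpartition -!/(flags_ok _).
rewrite flags_ok_cons /= is_partition_cons.
case: (boolP (odd y)) => [oy|_]; last by rewrite andbF.
rewrite odd_gt0 //=.
case: (leqP y n) => //= _; last by rewrite andbF.
case: (leqP y m) => //= ym; last by rewrite !andbF.
case: (is_partition _ _); rewrite ?andbF //=.
case: (flags_ok _); rewrite ?andbF //=.
case: (all odd _); rewrite ?andbF //= !andbT.
case: (boolP (all (leq^~ y) _)) => //= ys.
have -> : all (leq^~ m) (unzip1 s).
  by apply: sub_all ys => x /leq_trans; apply.
by rewrite andbT.
Qed.

Lemma ovo_pred_lt (m n : nat) (s : seq (nat * bool)) :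
  ovo_pred m n s -> all (fun p => p.2 ==> (p.1 != m.+1)) s.
Proof.
case/and3P=> _ _; rewrite all_map; apply: sub_all => -[y []] //=; lia.
Qed.

Lemma ovo_pred_nil (m n : nat) : ovo_pred m n [::] = (n == 0).
Proof.
by rewrite /ovo_pred /is_overpartition /is_partition /= !andbT eq_sym.
Qed.

Lemma ovo_le0 (n : nat) : ovo_le 0 n = (n == 0).
Proof.
apply: counts_unique (ovo_le_counts 0 n) _.
have [->|n0] := eqVneq n 0.
  exists [:: [::]]; split=> // -[|[y b] s]; rewrite !inE //.
  by rewrite -[RHS]/(ovo_pred 0 0 ((y, b) :: s)) ovo_pred_cons; case: y => // y;
    rewrite andbF.
apply: eq_counts (counts_pred0 _) => -[|[y b] s].
  by rewrite ovo_pred_nil (negPf n0).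
by rewrite ovo_pred_cons; case: y => // y; rewrite andbF.
Qed.

Lemma ovo_le_even (m n : nat) : ~~ odd m.+1 -> ovo_le m.+1 n = ovo_le m n.
Proof.
move=> om; apply: counts_unique (ovo_le_counts m.+1 n) _.
apply: eq_counts (ovo_le_counts m n) => -[|[y b] s].
  by rewrite !ovo_pred_nil.
rewrite !ovo_pred_cons; case: (boolP (odd y)) => //= oy; congr (_ && _).
rewrite [RHS]leq_eqVlt ltnS; case: eqP => // ym.
by rewrite ym (negPf om) in oy.
Qed.

(** A plain list avoids m+1 or is a non-overlined m+1 followed by a plain list, whence the factor (1
    - q^(m+1))^-1. *)
Lemma ovo_plain_leS (m n : nat) : odd m.+1 ->
  ovo_plain_le m.+1 n = ovo_le m n +
    (if m.+1 <= n then ovo_plain_le m.+1 (n - m.+1) else 0).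
Proof.
move=> om; apply: counts_unique (ovo_plain_le_counts m.+1 n) _.
apply: eq_counts (countsU _ (ovo_le_counts m n) (counts_cons_if (m.+1, false)
  (fun _ => ovo_plain_le_counts _ _))) => [] [|[y b] s] //.
- rewrite [RHS]/ovo_plain_pred !ovo_pred_cons /= xpair_eqE.
  case: eqP => [->|/eqP ym] /=.
    move: om => /= ->; rewrite ltnn leqnn /=; case: b; rewrite ?andbF //=.
    by rewrite /ovo_plain_pred -!andbA andbb.
  rewrite orbF implybT /=.
  have -> : (y <= m.+1) = (y <= m) by rewrite leq_eqVlt (negPf ym).
  (* Any flag may be put on [y] here; [false] makes the head's share of [ovo_pred_lt] trivial. *)
  case: (boolP [&& _, _, _ & _]) => //=; rewrite -(ovo_pred_cons m n y false).
  by move/ovo_pred_lt => /= ->.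
- rewrite ovo_pred_cons => /and4P[_ ym _ _] /=.
  by rewrite xpair_eqE; case: eqP => // yE; rewrite yE ltnn in ym.
Qed.

(** Only the leading copy of m+1 can be overlined, so a list is plain or is an overlined m+1
    followed by a plain list. This yields the factor 1 + q^(m+1). *)
Lemma ovo_leS (m n : nat) : odd m.+1 ->
  ovo_le m.+1 n = ovo_plain_le m.+1 n +
    (if m.+1 <= n then ovo_plain_le m.+1 (n - m.+1) else 0).
Proof.
move=> om; apply: counts_unique (ovo_le_counts m.+1 n) _.
apply: eq_counts (countsU _ (ovo_plain_le_counts m.+1 n)
  (counts_cons_if (m.+1, true) (fun _ => ovo_plain_le_counts _ _)))
  => [] [|[y b] s] //.
- by rewrite /cons_pred /ovo_plain_pred orbF !ovo_pred_nil ?andbT.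
- rewrite [in LHS]/ovo_plain_pred !ovo_pred_cons /= xpair_eqE.
  case: eqP => [->|/eqP ym] /=.
    move: om => /= ->; rewrite leqnn /=; case: b; last first.
      by rewrite orbF /ovo_plain_pred -!andbA andbb.
    by rewrite andbF.
  rewrite orbF implybT /=.
  case: (boolP [&& _, _, _ & _]) => //= /and4P[oy ym' yn].
  have : ovo_pred m n ((y, b) :: s) = ovo_plain_pred y (n - y) s.
    by rewrite ovo_pred_cons oy yn -ltnS ltn_neqAle ym ym'.
  by move=> <- /ovo_pred_lt /andP[].
- rewrite /ovo_plain_pred /= xpair_eqE => /and3P[_ + _].
  by case: b; rewrite ?andbF //= => /negPf->.
Qed.

(** * Product formulas for the generating functions *)

Section GeneratingFunctions.
Local Open Scope ring_scope.
Variable N : nat.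

(** Passing from M to M+1 admits the odd part 2M+1, giving 1 + q^(2M+1), then the even part 2M+2,
    giving the inverse of 1 - q^(2M+2). *)
Lemma pod_gf (M : nat) :
  eqtrunc N (gf N (pod_le M.*2) * \prod_(k < M) (1 - 'X^(k.+1.*2)))
            (\prod_(k < M) (1 + 'X^(k.*2.+1))).
Proof.
elim: M => [|M IHM].
  by rewrite !big_ord0 mulr1; apply: gf_delta0 => n; rewrite pod_le0.
rewrite !big_ord_recr /= doubleS [X in gf N _ * X]mulrC mulrA.
have even_step : eqtrunc N (gf N (pod_le M.*2.+2) * (1 - 'X^(M.*2.+2)))
                           (gf N (pod_le M.*2.+1)).
  by apply: gf_geom => n; rewrite pod_leS /= negbK odd_double.
have odd_step : eqtrunc N (gf N (pod_le M.*2.+1))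
                  (gf N (pod_le M.*2) + 'X^(M.*2.+1) * gf N (pod_le M.*2)).
  by apply: gf_rec => n; rewrite pod_leS /= odd_double.
apply: eqtrunc_trans (eqtruncMr _ (eqtrunc_trans even_step odd_step)) _.
rewrite -{1}[gf N (pod_le _)]mul1r -mulrDl -mulrA mulrC.
exact: eqtruncMr.
Qed.

Lemma ovo_gf (M : nat) :
  eqtrunc N (gf N (ovo_le M.*2) * odd_poch 'X M)
            (\prod_(k < M) (1 + 'X^(k.*2.+1))).
Proof.
elim: M => [|M IHM].
  by rewrite /odd_poch !big_ord0 mulr1; apply: gf_delta0 => n; rewrite ovo_le0.
have oddM : odd M.*2.+1 by rewrite /= odd_double.
rewrite odd_pochS big_ord_recr /= doubleS.
(* The bound 2M+2 is even, so it admits no new odd part. *)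
rewrite (eq_gf _ (b := ovo_le M.*2.+1)); last first.
  by move=> n; apply: ovo_le_even; rewrite /= negbK odd_double.
have plain_step : eqtrunc N (gf N (ovo_plain_le M.*2.+1) * (1 - 'X^(M.*2.+1)))
                            (gf N (ovo_le M.*2)).
  by apply: gf_geom => n; apply: ovo_plain_leS.
have step : eqtrunc N (gf N (ovo_le M.*2.+1)) (gf N (ovo_plain_le M.*2.+1) +
                         'X^(M.*2.+1) * gf N (ovo_plain_le M.*2.+1)).
  by apply: gf_rec => n; apply: ovo_leS.
apply: eqtrunc_trans (eqtruncMr _ step) _.
set U := gf N (ovo_plain_le _) in plain_step *; set x := 'X^(M.*2.+1).
have -> : (U + x * U) * (odd_poch 'X M * (1 - x)) =
          (1 + x) * odd_poch 'X M * (U * (1 - x)) by ring.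
apply: eqtrunc_trans (eqtruncMl _ plain_step) _.
rewrite -mulrA mulrC [odd_poch _ _ * _]mulrC.
exact: eqtruncMr.
Qed.

Lemma odd_poch_coef0 (M : nat) : (odd_poch 'X M : {poly rat})`_0 != 0.
Proof.
rewrite -horner_coef0 horner_prod prodf_seq_neq0; apply/allP => k _ /=.
by rewrite !hornerE /= exprS mul0r subr0 oner_neq0.
Qed.

(** After multiplication by [odd_poch 'X M] both sides become the product of the 1 + q^(2k+1), the
    left by [ovo_gf], the right by [gauss_trunc] and [pod_gf]. *)
Lemma pod_gf_triangular (M : nat) : (N <= M)%N ->
  eqtrunc N (gf N (ovo_le M.*2))
            ((\sum_(j < M.*2) 'X^(j * j.+1 %/ 2)) * gf N (pod_le M.*2)).
Proof.
move=> NM; apply: (eqtrunc_cancel (odd_poch_coef0 M)).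
rewrite mulrC mulrA; apply: eqtrunc_trans (ovo_gf M) _.
apply: eqtrunc_sym; apply: eqtrunc_trans (eqtruncMr _ (gauss_trunc NM)) _.
by rewrite mulrC; apply: pod_gf.
Qed.

End GeneratingFunctions.

(** * Comparison of coefficients *)

Local Open Scope classical_set_scope.
Local Open Scope ring_scope.

Theorem theorem3p1 (n : nat) :
  pobar n = \sum_(k \in [set: nat]) podz (n%:Z - (k * k.+1 %/ 2)%N%:Z).
Proof.
(* This is the range of the triangular sum in [pod_gf_triangular] taken at [n.+1]; from k = 2(n+1)
   on, the triangular numbers exceed n. *)
pose M := n.+1.*2.
have nM : (n <= M)%N by rewrite /M; lia.
rewrite -(fsbig_widen `I_M); first last.
- move=> k [_ /= /negP]; rewrite -leqNgt => Mk.
  have lt_n : (n < k * k.+1 %/ 2)%N.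
    by rewrite leq_divRL // /M in Mk *; nia.
  suff : n%:Z - (k * k.+1 %/ 2)%N%:Z < 0 by case: (_ - _).
  by rewrite Num.Theory.subr_lt0.
- by [].
rewrite -fsbig_ord.
apply/eqP; rewrite -(Num.Theory.eqr_nat rat) natr_sum; apply/eqP.
have /eqtruncP/(_ n (ltnSn n)) := @pod_gf_triangular n.+1 n.+1 (leqnn _).
rewrite coef_poly ltnSn -ovo_leE // => ->.
rewrite mulr_suml coef_sum; apply: eq_bigr => j _.
rewrite coefXnM coef_poly; case: ltnP => [n_lt|le_n].
  (* The coefficient is 0 here, and so is [podz], its argument being negative. *)
  suff : n%:Z - (j * j.+1 %/ 2)%N%:Z < 0 by case: (_ - _).
  by rewrite Num.Theory.subr_lt0.
rewrite ltnS leq_subr subzn //= -pod_leE //.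
by rewrite (leq_trans (leq_subr _ _)).
Qed.
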